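(* Let $\mathscr{A}$ be a category with finite limits, $\mathscr{P}$ a projective class in $\mathscr{A}$, and suppose that $P\xrightarrow{\partial}A$ is a $\mathscr{P}$-projective (precubical) resolution of $A\in\mathscr{A}$. Then: (a) $P$ has pseudodegeneracy operators, i.e., there exist $s_i: P_n\to P_{n+1}$, $n\ge0$, $1\le i\le n+1$, satisfying, for $\alpha\in\{0,1\}$, $$\partial_i^\alpha s_j=\begin{cases}s_{j-1}\partial_i^\alpha & i<j,\\ \mathrm{id} & i=j,\\ s_j\partial_{i-1}^\alpha & i>j.\end{cases}$$ (b) For any pseudodegeneracy operators $s_i: P_n\to P_{n+1}$, $n\ge0$, $1\le i\le n+1$, of $P$ (i.e. morphisms satisfying the identities in (a)), there exist $\Gamma_i: P_n\to P_{n+1}$, $n\ge1$, $1\le i\le n$, satisfying $$\partial_i^\alpha\Gamma_j=\begin{cases}\Gamma_{j-1}\partial_i^\alpha & i<j,\ \alpha\in\{0,1\},\\ \mathrm{id} & i=j,\,j+1,\ \alpha=0,\\ s_j\partial_j^\alpha & i=j,\,j+1,\ \alpha=1,\\ \Gamma_j\partial_{i-1}^\alpha & i>j+1,\ \alpha\in\{0,1\}.\end{cases}$$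
   Context: A precubical object $X$ in $\mathscr{A}$ is a family of objects $(X_n)_{n\ge 0}$ with face morphisms $\partial_i^0,\partial_i^1: X_n\to X_{n-1}$ ($1\le i\le n$) satisfying $\partial_i^\alpha\partial_j^\varepsilon=\partial_{j-1}^\varepsilon\partial_i^\alpha$ for $i<j$, $\alpha,\varepsilon\in\{0,1\}$. An augmented precubical object $X\xrightarrow{\partial}A$ is a precubical object $X$ with an object $A$ and a morphism $\partial: X_0\to A$ such that $\partial\partial_1^0=\partial\partial_1^1$. Given a class $\mathscr{P}$ of objects of $\mathscr{A}$, a morphism $f: B\to B'$ is $\mathscr{P}$-epimorphic if $\mathrm{Hom}_{\mathscr{A}}(Q,f)$ is surjective for all $Q\in\mathscr{P}$. $\mathscr{P}$ is a projective class if for each object $B$ there is a $\mathscr{P}$-epimorphic $e: Q\to B$ with $Q\in\mathscr{P}$. A cubical kernel of a sequence of morphisms $f_1^0,\dots,f_n^0,f_1^1,\dots,f_n^1: B\to C$ ($n\ge1$) is a sequence $k_1^0,\dots,k_{n+1}^0,k_1^1,\dots,k_{n+1}^1: K\to B$ with $f_i^\omega k_j^\alpha=f_{j-1}^\alpha k_i^\omega$ for $1\le i<j\le n+1$, $\omega,\alpha\in\{0,1\}$, which is universal: for any sequence $h_1^0,\dots,h_{n+1}^0,h_1^1,\dots,h_{n+1}^1: D\to B$ satisfying the same identities there is a unique $h: D\to K$ with $k_i^\omega h=h_i^\omega$ for all $i,\omega$. For an augmented precubical object $X\xrightarrow{\partial}A$, let $k_1^0,k_1^1: K_1\to X_0$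 be the kernel pair of $\partial: X_0\to A$ and, for $n\ge2$, let $k_1^0,\dots,k_n^0,k_1^1,\dots,k_n^1: K_n\to X_{n-1}$ be a cubical kernel of $(\partial_1^0,\dots,\partial_{n-1}^0,\partial_1^1,\dots,\partial_{n-1}^1)$, the faces $X_{n-1}\to X_{n-2}$. Let $e_n: X_n\to K_n$ ($n\ge1$) be the unique morphism with $k_i^\varepsilon e_n=\partial_i^\varepsilon$. Then $X\xrightarrow{\partial}A$ is $\mathscr{P}$-projective if every $X_n\in\mathscr{P}$ ($n\ge0$), $\mathscr{P}$-exact if $\partial$ and all $e_n$ ($n\ge1$) are $\mathscr{P}$-epimorphic, and a $\mathscr{P}$-projective resolution of $A$ if it is both $\mathscr{P}$-projective and $\mathscr{P}$-exact. *)

(* Defs.v *)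
From mathcomp Require Import all_boot.

Set Implicit Arguments.
Unset Strict Implicit.
Unset Printing Implicit Defensive.

Declare Scope cat_scope.
Delimit Scope cat_scope with cat.

Record category : Type := Category {
  obj :> Type;
  hom : obj -> obj -> Type;
  idm : forall a : obj, hom a a;
  comp : forall a b c : obj, hom b c -> hom a b -> hom a c;
  comp_idl : forall (a b : obj) (f : hom a b), comp (idm b) f = f;
  comp_idr : forall (a b : obj) (f : hom a b), comp f (idm a) = f;
  compA : forall (a b c d : obj) (h : hom c d) (g : hom b c) (f : hom a b),
    comp h (comp g f) = comp (comp h g) f }.

Arguments hom {c} a b : rename.
Arguments idm {c} a : rename.
Arguments comp {c a b} {c0} g f : rename.

Notation "g ∘ f" := (comp g f) (at level 40, left associativity) : cat_scope.
Local Open Scope cat_scope.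

Record functor (J A : category) : Type := Functor {
  fobj :> J -> A;
  fmap : forall a b : J, hom a b -> hom (fobj a) (fobj b);
  fmap_id : forall a : J, fmap (idm a) = idm (fobj a);
  fmap_comp : forall (a b c : J) (g : hom b c) (f : hom a b),
    fmap (g ∘ f) = fmap g ∘ fmap f }.

Record cone (J A : category) (F : functor J A) : Type := Cone {
  apex : A;
  leg : forall j : J, hom apex (F j);
  leg_natural : forall (i j : J) (u : hom i j), fmap F u ∘ leg i = leg j }.

Definition is_limit (J A : category) (F : functor J A) (L : cone F) : Prop :=
  forall D : cone F,
    exists! h : hom (apex D) (apex L), forall j : J, leg L j ∘ h = leg D j.

Definition finite_type (T : Type) : Prop :=
  exists (n : nat) (f : 'I_n -> T), bijective f.

Definition finite_category (J : category) : Prop :=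
  finite_type J /\ forall a b : J, finite_type (hom a b).

Definition has_finite_limits (A : category) : Prop :=
  forall J : category, finite_category J ->
  forall F : functor J A, exists L : cone F, is_limit L.

Section ProjectiveClass.
Variables (A : category) (P : A -> Prop).

Definition P_epimorphic (B B' : A) (f : hom B B') : Prop :=
  forall Q : A, P Q -> forall g : hom Q B', exists h : hom Q B, f ∘ h = g.

Definition projective_class : Prop :=
  forall B : A, exists (Q : A) (e : hom Q B), P Q /\ P_epimorphic e.

End ProjectiveClass.

(* A superscript in {0,1} is a boolean, with false for 0 and true for 1.
   A subscript is a natural number, counted from 1 as usual for cubical
   objects; families of morphisms are total in it, but every condition below
   only concerns subscripts in the proper range, so that the values outside
   that range are irrelevant. *)

(* [face n a i] is the face from degree n.+1 to degree n, for 1 <= i <= n.+1. *)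
Record precubical (A : category) : Type := Precubical {
  cells :> nat -> A;
  face : forall n : nat, bool -> nat -> hom (cells n.+1) (cells n);
  face_face : forall (n : nat) (a e : bool) (i j : nat),
    1 <= i < j -> j <= n.+2 ->
    face n a i ∘ face n.+1 e j = face n e j.-1 ∘ face n.+1 a i }.

Arguments face {A} p n a i : rename.

Record augmented (A : category) (B : A) : Type := Augmented {
  precub :> precubical A;
  aug : hom (precub 0) B;
  aug_face : aug ∘ face precub 0 false 1 = aug ∘ face precub 0 true 1 }.

Section Kernels.
Variable A : category.

Definition is_kernel_pair (B C : A) (f : hom B C) (K : A)
    (k : bool -> hom K B) : Prop :=
  f ∘ k false = f ∘ k true /\
  forall (D : A) (h : bool -> hom D B), f ∘ h false = f ∘ h true ->
    exists! u : hom D K, forall a : bool, k a ∘ u = h a.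

Definition cubical_compatible (n : nat) (B C : A)
    (f : bool -> nat -> hom B C) (D : A) (h : bool -> nat -> hom D B) : Prop :=
  forall (i j : nat) (w a : bool), 1 <= i < j -> j <= n.+1 ->
    f w i ∘ h a j = f a j.-1 ∘ h w i.

Definition is_cubical_kernel (n : nat) (B C : A)
    (f : bool -> nat -> hom B C) (K : A) (k : bool -> nat -> hom K B) : Prop :=
  cubical_compatible n f k /\
  forall (D : A) (h : bool -> nat -> hom D B), cubical_compatible n f h ->
    exists! u : hom D K,
      forall (i : nat) (w : bool), 1 <= i <= n.+1 -> k w i ∘ u = h w i.

End Kernels.

Section Resolutions.
Variables (A : category) (P : A -> Prop) (B : A) (X : augmented B).

Definition P_projective : Prop := forall n : nat, P (X n).

(* Kernel pairs and cubical kernels are determined up to isomorphism, hence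
   the quantification over all of them; they exist if A has finite limits.
   In the last clause X n.+2 is compared with the cubical kernel of the n.+1
   pairs of faces from X n.+1 to X n. *)
Definition P_exact : Prop :=
  [/\ P_epimorphic P (aug X),
      forall (K : A) (k : bool -> hom K (X 0)), is_kernel_pair (aug X) k ->
      forall e : hom (X 1) K,
        (forall a : bool, k a ∘ e = face X 0 a 1) ->
        P_epimorphic P e
    & forall (n : nat) (K : A) (k : bool -> nat -> hom K (X n.+1)),
      is_cubical_kernel n.+1 (face X n) k ->
      forall e : hom (X n.+2) K,
        (forall (i : nat) (a : bool), 1 <= i <= n.+2 ->
           k a i ∘ e = face X n.+1 a i) ->
        P_epimorphic P e].

Definition P_projective_resolution : Prop := P_projective /\ P_exact.

End Resolutions.

Section Operators.
Variables (A : category) (X : precubical A).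

(* [s n j] is s_j : X_n -> X_(n+1), for 1 <= j <= n+1. In degree 0 the only
   identity is the one with i = j = 1, so that the two shifting identities
   start in degree 1. *)
Definition pseudodegeneracies
    (s : forall n : nat, nat -> hom (X n) (X n.+1)) : Prop :=
  [/\ forall (n i j : nat) (a : bool), 1 <= i < j -> j <= n.+2 ->
        face X n.+1 a i ∘ s n.+1 j = s n j.-1 ∘ face X n a i,
      forall (n j : nat) (a : bool), 1 <= j <= n.+1 ->
        face X n a j ∘ s n j = idm (X n)
    & forall (n i j : nat) (a : bool), 1 <= j < i -> i <= n.+2 ->
        face X n.+1 a i ∘ s n.+1 j = s n j ∘ face X n a i.-1].

(* [G n j] is Gamma_j : X_(n+1) -> X_(n+2), for 1 <= j <= n+1: there is no
   connection in degree 0, and the shifting identities start in degree 2. *)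
Definition connections (s : forall n : nat, nat -> hom (X n) (X n.+1))
    (G : forall n : nat, nat -> hom (X n.+1) (X n.+2)) : Prop :=
  [/\ forall (n i j : nat) (a : bool), 1 <= i < j -> j <= n.+2 ->
        face X n.+2 a i ∘ G n.+1 j = G n j.-1 ∘ face X n.+1 a i,
      forall n i j : nat, 1 <= j <= n.+1 -> i = j \/ i = j.+1 ->
        face X n.+1 false i ∘ G n j = idm (X n.+1),
      forall n i j : nat, 1 <= j <= n.+1 -> i = j \/ i = j.+1 ->
        face X n.+1 true i ∘ G n j = s n j ∘ face X n true j
    & forall (n i j : nat) (a : bool), 1 <= j -> j.+1 < i <= n.+3 ->
        face X n.+2 a i ∘ G n.+1 j = G n j ∘ face X n.+1 a i.-1].

End Operators.

(* Main.v *)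
(* P-exactness, together with the existence of kernel pairs and cubical kernels,
   says that out of an object of P one can prescribe the faces of a morphism
   into X_(n+1) freely, subject only to the cubical compatibility relations.
   The required identities prescribe all the faces of s_j and Gamma_j in terms
   of the operators one degree below, and the identities one degree below are
   exactly what makes these prescribed faces compatible; so both families are
   built degree by degree. *)

From mathcomp Require Import all_boot zify.
From mathcomp Require Import boolp.
Require Import Defs.

Set Implicit Arguments.
Unset Strict Implicit.
Unset Printing Implicit Defensive.

Local Open Scope cat_scope.

(** * Kernel pairs and cubical kernels as finite limits *)

Lemma finite_type_fin (T : finType) : finite_type T.
Proof.
exists #|T|, (@enum_val T predT).
by exists enum_rank; [exact: enum_valK | exact: enum_rankK].
Qed.

Section EdgeCategory.
Variables (V E : finType) (ends : bool -> E -> V).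

(* An arrow is either the identity, coded by [None], or one of the two arrows
   into [inr e], coded by [Some b]. *)
Definition edge_arrow (x y : V + E) (c : option bool) : bool :=
  match c, x, y with
  | None, _, _ => x == y
  | Some b, inl v, inr e => ends b e == v
  | _, _, _ => false
  end.

Definition edge_hom (x y : V + E) : finType := {c | edge_arrow x y c}.

Lemma edge_id_subproof (x : V + E) : edge_arrow x x None.
Proof. exact: eqxx. Qed.

Definition edge_id (x : V + E) : edge_hom x x := Sub None (edge_id_subproof x).

(** No two non-identity arrows are composable, so a composite takes the code of whichever factor is
    not an identity. *)
Definition edge_code (d c : option bool) : option bool :=
  if d is None then c else d.

Lemma edge_comp_subproof (x y z : V + E) (g : edge_hom y z) (f : edge_hom x y) :
  edge_arrow x z (edge_code (val g) (val f)).
Proof.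
case: g f => [[b|] /= gP] [[c|] /= fP] //=.
- by case: y gP fP => // v; case: x.
- by move/eqP: fP => ->.
- by move/eqP: gP => <-.
- by move/eqP: fP => ->.
Qed.

Definition edge_comp (x y z : V + E) (g : edge_hom y z) (f : edge_hom x y) :
  edge_hom x z := Sub (edge_code (val g) (val f)) (edge_comp_subproof g f).

Lemma edge_comp_idl (x y : V + E) (f : edge_hom x y) :
  edge_comp (edge_id y) f = f.
Proof. exact: val_inj. Qed.

Lemma edge_comp_idr (x y : V + E) (f : edge_hom x y) :
  edge_comp f (edge_id x) = f.
Proof. by apply: val_inj => /=; case: (sval f). Qed.

Lemma edge_compA (x y z t : V + E) (h : edge_hom z t) (g : edge_hom y z)
    (f : edge_hom x y) :
  edge_comp h (edge_comp g f) = edge_comp (edge_comp h g) f.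
Proof. by apply: val_inj => /=; case: (sval h). Qed.

(** The shape of a graph: each edge receives one arrow from each of its ends, and these stay
    distinct when the ends coincide. With all vertices sent to [B] and all edges to [C], a cone
    amounts to a family of morphisms into [B], indexed by [V], subject to one equation per edge. *)
Definition edge_category : category :=
  @Category (V + E)%type edge_hom edge_id edge_comp
    edge_comp_idl edge_comp_idr edge_compA.

Lemma edge_category_finite : finite_category edge_category.
Proof. by split=> [|x y]; exact: finite_type_fin. Qed.

Variables (A : category) (B C : A) (p : bool -> E -> hom B C).

Definition edge_fobj (x : edge_category) : A := if x is inl _ then B else C.

(** The default of [odflt] is never reached, since an arrow from a vertex to an edge is not an
    identity; from an edge to a vertex there is no arrow at all. *)
Definition edge_fmap (x y : edge_category) :
    hom x y -> hom (edge_fobj x) (edge_fobj y) :=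
  match x, y return hom (c := edge_category) x y ->
                    hom (edge_fobj x) (edge_fobj y) with
  | inl _, inl _ => fun=> idm B
  | inl _, inr e => fun u => p (odflt false (val u)) e
  | inr e, inl v => fun u =>
      False_rect _ (let: exist c cP := u in
        match c return edge_arrow (inr e) (inl v) c -> False with
        | Some _ => fun h => notF h
        | None => fun h => notF h
        end cP)
  | inr _, inr _ => fun=> idm C
  end.

Lemma edge_fmap_id (x : edge_category) :
  edge_fmap (idm x) = idm (edge_fobj x).
Proof. by case: x. Qed.

Lemma edge_fmap_comp (x y z : edge_category) (g : hom y z) (f : hom x y) :
  edge_fmap (g ∘ f) = edge_fmap g ∘ edge_fmap f.
Proof.
case: x y z g f => [v|e] [v'|e'] [v''|e''] [[b|] gP] [[c|] fP] //=;
  rewrite ?comp_idl ?comp_idr //.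
by move/eqP: gP => [->].
Qed.

Definition edge_functor : functor edge_category A :=
  Functor edge_fmap_id edge_fmap_comp.

Definition edge_compatible (D : A) (h : V -> hom D B) : Prop :=
  forall e, p false e ∘ h (ends false e) = p true e ∘ h (ends true e).

Lemma finite_limits_edge :
  has_finite_limits A ->
  exists (K : A) (k : V -> hom K B), edge_compatible k /\
    forall (D : A) (h : V -> hom D B), edge_compatible h ->
    exists! u : hom D K, forall v, k v ∘ u = h v.
Proof.
move=> /(_ _ edge_category_finite edge_functor) [L Llim].
have arrowP b e : edge_arrow (inl (ends b e)) (inr e) (Some b) by exact: eqxx.
pose arrow b e : hom (c := edge_category) (inl (ends b e)) (inr e) :=
  Sub (Some b) (arrowP b e).
have legE b e : p b e ∘ leg L (inl (ends b e)) = leg L (inr e).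
  exact: (leg_natural L (arrow b e)).
exists (apex L), (fun v => leg L (inl v)); split.
  by move=> e; rewrite (legE false) (legE true).
move=> D h hE.
(* The leg at an edge is forced by the legs at its ends; it is computed at the end [false], and [hE]
   gives agreement at the other. *)
pose l (x : edge_category) : hom D (edge_functor x) :=
  match x return hom D (edge_functor x) with
  | inl v => h v
  | inr e => p false e ∘ h (ends false e)
  end.
have l_nat (x y : edge_category) (u : hom x y) :
    fmap edge_functor u ∘ l x = l y.
  case: x u => [v|e]; case: y => [v'|e'] [[b|] //= uP];
    rewrite ?comp_idl //.
  - by move/eqP: uP => [->].
  - by move/eqP: uP => <-; case: b; rewrite ?hE.
  - by move/eqP: uP => [->].
have [u [uL u_uniq]] := Llim (Cone l_nat).
exists u; split=> [v|u' u'L]; first exact: (uL (inl v)).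
apply: u_uniq => -[v|e] /=; first exact: u'L.
by rewrite -(legE false) -compA u'L.
Qed.

End EdgeCategory.

(** The graph is a single edge joining [false] and [true], with both arrows sent to [f]. *)
Lemma kernel_pair_exists (A : category) (B C : A) (f : hom B C) :
  has_finite_limits A ->
  exists (K : A) (k : bool -> hom K B), is_kernel_pair f k.
Proof.
move=> lim.
have [K [k [kE kU]]] := @finite_limits_edge bool unit (fun b _ => b) A B C
  (fun _ _ => f) lim.
exists K, k; split; first exact: (kE tt).
by move=> D h hE; apply: kU => e.
Qed.

(** The graph has a vertex for each pair of a superscript and a subscript, and an edge for each
    cubical identity. *)
Lemma cubical_kernel_exists (A : category) (n : nat) (B C : A)
    (f : bool -> nat -> hom B C) :
  has_finite_limits A ->
  exists (K : A) (k : bool -> nat -> hom K B), is_cubical_kernel n f k.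
Proof.
move=> lim.
(* Ordinals count from 0, subscripts from 1. *)
pose E : finType := {x : ('I_n.+1 * 'I_n.+1) * (bool * bool) | x.1.1 < x.1.2}.
pose ends (b : bool) (e : E) : bool * 'I_n.+1 :=
  let: (i, j, (w, a)) := val e in if b then (w, i) else (a, j).
(* The ordinals [i] and [j] stand for the subscripts [i.+1] and [j.+1], so [f a j] already carries
   the lowered second subscript. *)
pose p (b : bool) (e : E) : hom B C :=
  let: (i, j, (w, a)) := val e in if b then f a j else f w i.+1.
have [K [k [kE kU]]] := @finite_limits_edge _ _ ends A B C p lim.
exists K, (fun a i => k (a, inord i.-1)); split.
  move=> i j w a ij jn.
  have eP : (inord i.-1 : 'I_n.+1) < (inord j.-1 : 'I_n.+1).
    by rewrite !inordK; lia.
  have := kE (Sub ((inord i.-1, inord j.-1), (w, a)) eP).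
  rewrite /p /ends /= !inordK; [|lia..].
  by rewrite prednK //; lia.
move=> D h hE.
have [|u [uk u_uniq]] := kU D (fun v => h v.1 v.2.+1).
  move=> [[[i j] [w a]] /= ij].
  by apply: (hE i.+1 j.+1) => //; have := ltn_ord j; lia.
exists u; split=> [i w iP|u' u'k].
  by rewrite uk /= inordK ?prednK //; lia.
apply: u_uniq => -[w i] /=.
rewrite -u'k; last by have := ltn_ord i; lia.
by congr (k (_, _) ∘ _); apply: val_inj; rewrite /= inordK.
Qed.

(** * Morphisms with prescribed faces *)

Section Lifting.
Variables (A : category) (P : A -> Prop) (B : A) (X : augmented B).
Hypotheses (lim : has_finite_limits A) (exact : P_exact P X).

(** The pair [h] factors through the kernel pair of the augmentation, and the factor lifts along the
    P-epimorphic comparison from [X 1]. *)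
Lemma P_exact_lift0 (Q : A) (h : bool -> hom Q (X 0)) :
  P Q -> aug X ∘ h false = aug X ∘ h true ->
  exists u : hom Q (X 1), forall a, face X 0 a 1 ∘ u = h a.
Proof.
case: exact => _ epi _ PQ hE.
have [K [k kP]] := kernel_pair_exists (aug X) lim.
have [_ kU] := kP.
have [e [eE _]] := kU _ (fun a => face X 0 a 1) (aug_face X).
have [v [vE _]] := kU _ h hE.
have [u uE] := epi K k kP e eE Q PQ v.
by exists u => a; rewrite -eE -compA uE.
Qed.

Lemma P_exact_liftS (n : nat) (Q : A) (h : bool -> nat -> hom Q (X n.+1)) :
  P Q -> cubical_compatible n.+1 (face X n) h ->
  exists u : hom Q (X n.+2), forall i a, 1 <= i <= n.+2 ->
    face X n.+1 a i ∘ u = h a i.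
Proof.
case: exact => _ _ epi PQ hE.
have [K [k kP]] := cubical_kernel_exists n.+1 (face X n) lim.
have [_ kU] := kP.
have [|e [eE _]] := kU _ (face X n.+1).
  by move=> i j w a; exact: face_face.
have [v [vE _]] := kU _ h hE.
have [u uE] := epi n K k kP e eE Q PQ v.
by exists u => i a ir; rewrite -eE // -compA uE vE.
Qed.

End Lifting.

(** * Choice principles *)

(** Dependent choice with an invariant: the recursion runs in the subtype cut out by [C], so each
    step has its hypothesis at hand. *)
Lemma dependent_sequence (T : nat -> Type) (C : forall n, T n -> Prop)
    (R : forall n, T n -> T n.+1 -> Prop) :
  (exists x, C 0 x) ->
  (forall n x, C n x -> exists y, C n.+1 y /\ R n x y) ->
  exists f : forall n, T n, forall n, C n (f n) /\ R n (f n) (f n.+1).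
Proof.
move=> /cid[x0 x0C] step.
have next n (x : {x | C n x}) : {y : {y | C n.+1 y} | R n (sval x) (sval y)}.
  by case: x => x xC; have /cid[y [yC xy]] := step n x xC; exists (exist _ y yC).
pose fix f n : {x | C n x} :=
  if n is m.+1 then sval (next m (f m)) else exist _ x0 x0C.
exists (fun n => sval (f n)) => n; split; first exact: svalP (f n).
exact: svalP (next n (f n)).
Qed.

Lemma choice_in_range (T : Type) (m : nat) (Q : nat -> T -> Prop) :
  (forall j, 1 <= j <= m.+1 -> exists u, Q j u) ->
  exists f : nat -> T, forall j, 1 <= j <= m.+1 -> Q j (f j).
Proof.
move=> ex.
have [|f fQ] := @choice nat T (fun j u => 1 <= j <= m.+1 -> Q j u).
  move=> j; case: (boolP (1 <= j <= m.+1)) => [/ex[u uQ]|_]; first by exists u.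
  (* Out of range any value will do; the index 1 is always in range, so [T] is inhabited. *)
  by have [|u _] := ex 1; [|exists u].
by exists f.
Qed.

(** * Compatibility of the prescribed faces of a degeneracy *)

Section Degeneracies.
Variables (A : category) (X : precubical A).

(* The prescribed faces of the degeneracy s_j in degree n.+1. *)
Definition degeneracy_faces (n : nat) (s : nat -> hom (X n) (X n.+1))
    (j : nat) (a : bool) (i : nat) : hom (X n.+1) (X n.+1) :=
  if i < j then s j.-1 ∘ face X n a i
  else if i == j then idm (X n.+1) else s j ∘ face X n a i.-1.

Definition degeneracy_sections (n : nat) (s : nat -> hom (X n) (X n.+1)) :=
  forall j a, 1 <= j <= n.+1 -> face X n a j ∘ s j = idm (X n).

Definition degeneracies_extend (n : nat) (s : nat -> hom (X n) (X n.+1))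
    (s' : nat -> hom (X n.+1) (X n.+2)) :=
  forall i j a, 1 <= j <= n.+2 -> 1 <= i <= n.+2 ->
    face X n.+1 a i ∘ s' j = degeneracy_faces s j a i.

(* [U j a i] plays the role of s_j ∂_i^a : X_n -> X_(n-1) -> X_n, which does
   not exist for n = 0; there the assumptions on U are void. *)
Lemma degeneracy_faces_compatible (n : nat) (s : nat -> hom (X n) (X n.+1))
    (U : nat -> bool -> nat -> hom (X n) (X n)) :
  degeneracy_sections s ->
  (forall i j a, 1 <= i < j -> j <= n.+1 -> face X n a i ∘ s j = U j.-1 a i) ->
  (forall i j a, 1 <= j < i -> i <= n.+1 -> face X n a i ∘ s j = U j a i.-1) ->
  (forall i i' j w a, 1 <= j <= n -> 1 <= i < i' -> i' <= n.+1 ->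
     U j w i ∘ face X n a i' = U j a i'.-1 ∘ face X n w i) ->
  forall j, 1 <= j <= n.+2 ->
    cubical_compatible n.+1 (face X n) (degeneracy_faces s j).
Proof.
move=> sK sl sr UE j jP i i' w a ii' i'P; rewrite /degeneracy_faces.
(* Since [i < i'], five positions relative to [j] remain: both below, on either side, both above,
   [i = j] and [i' = j]. The first three reduce to [UE]; in the last two a face cancels a
   degeneracy. *)
have [i'j|ji'|i'j] := ltngtP i' j; have [ij|ji|ij] := ltngtP i j; try lia;
  rewrite ?comp_idl ?comp_idr ?compA.
- by rewrite !sl 1?UE //; lia.
- by rewrite sl ?sr 1?UE //; lia.
- by rewrite !sr 1?UE //; lia.
- by rewrite -ij sK ?comp_idl //; lia.
- by rewrite i'j sK ?comp_idl //; lia.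
Qed.

End Degeneracies.

(** * Compatibility of the prescribed faces of a connection *)

Section Connections.
Variables (A : category) (X : precubical A).
Variables (s : forall n : nat, nat -> hom (X n) (X n.+1)).

(* The two middle faces of Gamma_j in degree n.+1. *)
Definition connection_middle (n j : nat) (a : bool) : hom (X n.+1) (X n.+1) :=
  if a then s n j ∘ face X n true j else idm (X n.+1).

(* The prescribed faces of Gamma_j in degree n.+2. *)
Definition connection_faces (n : nat) (G : nat -> hom (X n.+1) (X n.+2))
    (j : nat) (a : bool) (i : nat) : hom (X n.+2) (X n.+2) :=
  if i < j then G j.-1 ∘ face X n.+1 a i
  else if i <= j.+1 then connection_middle n.+1 j a
  else G j ∘ face X n.+1 a i.-1.

Definition connection_centered (n : nat) (G : nat -> hom (X n.+1) (X n.+2)) :=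
  forall i j a, 1 <= j <= n.+1 -> j <= i <= j.+1 ->
    face X n.+1 a i ∘ G j = connection_middle n j a.

Definition connections_extend (n : nat) (G : nat -> hom (X n.+1) (X n.+2))
    (G' : nat -> hom (X n.+2) (X n.+3)) :=
  forall i j a, 1 <= j <= n.+2 -> 1 <= i <= n.+3 ->
    face X n.+2 a i ∘ G' j = connection_faces G j a i.

Hypothesis sP : pseudodegeneracies s.

(** For [a = true] the face moves past the degeneracy and then past the face at [j], lowering the
    subscript of each to [j.-1]. *)
Lemma connection_middle_low (n i j : nat) (w a : bool) :
  1 <= i < j -> j <= n.+2 ->
  face X n.+1 w i ∘ connection_middle n.+1 j a =
  connection_middle n j.-1 a ∘ face X n.+1 w i.
Proof.
case: sP => sl _ _ ij jn; case: a => /=; last by rewrite comp_idl comp_idr.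
by rewrite compA sl // -!compA face_face.
Qed.

(** For [a = true] the face drops to [i.-2] on crossing the degeneracy and returns to [i.-1] on
    crossing the face at [j]. *)
Lemma connection_middle_high (n i j : nat) (w a : bool) :
  1 <= j -> j.+1 < i -> i <= n.+3 ->
  face X n.+1 w i.-1 ∘ connection_middle n.+1 j a =
  connection_middle n j a ∘ face X n.+1 w i.-1.
Proof.
case: sP => _ _ sr j0 ji iP; case: a => /=; last by rewrite comp_idl comp_idr.
by rewrite compA sr -?compA ?(@face_face _ _ _ true w j) //; lia.
Qed.

(** This relates the two middle faces of a connection to each other. When [w] and [a] differ, the
    face at [j] cancels the degeneracy and both sides become the face at [j] with superscript
    [true]. *)
Lemma connection_middle_swap (n j : nat) (w a : bool) :
  1 <= j <= n.+1 ->
  face X n w j ∘ connection_middle n j a =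
  face X n a j ∘ connection_middle n j w.
Proof.
case: sP => _ sK _ jP.
by case: w; case: a => //=; rewrite comp_idr compA sK // comp_idl.
Qed.

(* [U] plays the role of Gamma_j ∂_i^a, as in [degeneracy_faces_compatible]. *)
Lemma connection_faces_compatible (n : nat) (G : nat -> hom (X n.+1) (X n.+2))
    (U : nat -> bool -> nat -> hom (X n.+1) (X n.+1)) :
  connection_centered G ->
  (forall i j a, 1 <= i < j -> j <= n.+1 ->
     face X n.+1 a i ∘ G j = U j.-1 a i) ->
  (forall i j a, 1 <= j -> j.+1 < i <= n.+2 ->
     face X n.+1 a i ∘ G j = U j a i.-1) ->
  (forall i i' j w a, 1 <= j <= n -> 1 <= i < i' -> i' <= n.+2 ->
     U j w i ∘ face X n.+1 a i' = U j a i'.-1 ∘ face X n.+1 w i) ->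
  forall j, 1 <= j <= n.+2 ->
    cubical_compatible n.+2 (face X n.+1) (connection_faces G j).
Proof.
move=> Gm Gl Gr UE j jP i i' w a ii' i'P; rewrite /connection_faces.
have [ij|ji] := ltnP i j; have [i'j|ji'] := ltnP i' j; try lia.
- by rewrite !compA !Gl 1?UE //; lia.
- have [i'j1|ji'1] := leqP i' j.+1.
    by rewrite connection_middle_low ?compA ?Gm //; lia.
  by rewrite !compA Gl ?Gr 1?UE //; lia.
- have [i'j1|ji'1] := leqP i' j.+1; have [ij1|ji1] := leqP i j.+1; try lia.
  (* Two distinct middle subscripts can only be [j] and [j.+1]. *)
  + have -> : i' = j.+1 by lia.
    have -> : i = j by lia.
    by rewrite connection_middle_swap //; lia.
  + by rewrite compA Gm ?connection_middle_high //; lia.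
  + by rewrite !compA !Gr 1?UE //; lia.
Qed.

End Connections.

(** * Construction of the degeneracies *)

Section Resolution.
Variables (A : category) (P : A -> Prop) (B : A) (X : augmented B).
Hypotheses (lim : has_finite_limits A) (resX : P_projective_resolution P X).

Lemma projective_cells (n : nat) : P (X n).
Proof. by case: resX. Qed.

Lemma exact_cells : P_exact P X.
Proof. by case: resX. Qed.

(** The pair of two identities of [X 0] is equalized by the augmentation, hence lifts to [X 1]. *)
Lemma degeneracies_base : exists s : nat -> hom (X 0) (X 1),
  degeneracy_sections s.
Proof.
have [|u uE] := @P_exact_lift0 _ _ _ _ lim exact_cells (X 0) (fun=> idm (X 0))
  (projective_cells 0).
  by [].
by exists (fun=> u) => j a jP; have -> : j = 1 by lia.
Qed.

Lemma degeneracies_step (n : nat) (s : nat -> hom (X n) (X n.+1)) :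
  (forall j, 1 <= j <= n.+2 ->
     cubical_compatible n.+1 (face X n) (degeneracy_faces s j)) ->
  exists s' : nat -> hom (X n.+1) (X n.+2), degeneracies_extend s s'.
Proof.
move=> sC.
have [j /sC hC|s' s'E] := @choice_in_range _ n.+1 (fun j u =>
    forall i a, 1 <= i <= n.+2 -> face X n.+1 a i ∘ u = degeneracy_faces s j a i).
  exact (P_exact_liftS lim exact_cells (projective_cells n.+1) hC).
by exists s' => i j a jP; exact: s'E.
Qed.

Lemma degeneracies_extendP (n : nat) (s : nat -> hom (X n) (X n.+1))
    (s' : nat -> hom (X n.+1) (X n.+2)) :
  degeneracies_extend s s' ->
  [/\ forall i j a, 1 <= i < j -> j <= n.+2 ->
        face X n.+1 a i ∘ s' j = s j.-1 ∘ face X n a i,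
      degeneracy_sections s'
    & forall i j a, 1 <= j < i -> i <= n.+2 ->
        face X n.+1 a i ∘ s' j = s j ∘ face X n a i.-1].
Proof.
rewrite /degeneracies_extend /degeneracy_faces => sE.
split=> [i j a ij jn|j a jP|i j a ji iP]; rewrite sE; try lia.
- by have -> : i < j by lia.
- by rewrite ltnn eqxx.
- by have [-> ->] : (i < j) = false /\ (i == j) = false by lia.
Qed.

Lemma pseudodegeneracies_exist :
  exists s : forall n, nat -> hom (X n) (X n.+1), pseudodegeneracies s.
Proof.
(* Compatibility of the next prescribed faces belongs to the invariant: its proof uses the
   identities linking [s] to the degree below, known only when [s] is constructed. *)
pose C n (s : nat -> hom (X n) (X n.+1)) := degeneracy_sections s /\
  forall j, 1 <= j <= n.+2 ->
    cubical_compatible n.+1 (face X n) (degeneracy_faces s j).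
have [||s sP] := @dependent_sequence _ C (fun n => @degeneracies_extend A X n).
- have [s sK] := degeneracies_base; exists s; split=> //.
  by apply: (degeneracy_faces_compatible (U := fun _ _ _ => idm _)) => // *; lia.
- move=> n s [sK /degeneracies_step[s' s'E]]; exists s'; split=> //.
  have [sl s'K sr] := degeneracies_extendP s'E; split=> //.
  apply: (degeneracy_faces_compatible
    (U := fun j a i => s j ∘ face X n a i)) => // i i' j w a jP ii' i'P.
  by rewrite -!compA face_face.
exists s; split=> [n|n|n]; last 1 first.
- by have [_ /degeneracies_extendP[]] := sP n.
- by have [_ /degeneracies_extendP[]] := sP n.
- by have [[]] := sP n.
Qed.

(** * Construction of the connections over given degeneracies *)

Section Connections.
Variable s : forall n, nat -> hom (X n) (X n.+1).
Hypothesis sP : pseudodegeneracies s.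

(** Both subscripts, 1 and 2, are middle ones here, so the only compatibility relation is the swap
    of the middle faces. *)
Lemma connections_base : exists G : nat -> hom (X 1) (X 2),
  connection_centered s G.
Proof.
have [|u uE] := @P_exact_liftS _ _ _ _ lim exact_cells 0 (X 1)
  (fun a _ => connection_middle s 0 1 a) (projective_cells 1).
  move=> i j w a ij jP; have [-> ->] : i = 1 /\ j = 2 by lia.
  exact: connection_middle_swap.
exists (fun=> u) => i j a jP iP; have j1 : j = 1 by lia.
by rewrite j1 uE //; lia.
Qed.

Lemma connections_step (n : nat) (G : nat -> hom (X n.+1) (X n.+2)) :
  (forall j, 1 <= j <= n.+2 ->
     cubical_compatible n.+2 (face X n.+1) (connection_faces s G j)) ->
  exists G' : nat -> hom (X n.+2) (X n.+3), connections_extend s G G'.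
Proof.
move=> GC.
have [j /GC hC|G' G'E] := @choice_in_range _ n.+1 (fun j u =>
    forall i a, 1 <= i <= n.+3 ->
    face X n.+2 a i ∘ u = connection_faces s G j a i).
  exact (P_exact_liftS lim exact_cells (projective_cells n.+2) hC).
by exists G' => i j a jP; exact: G'E.
Qed.

Lemma connections_extendP (n : nat) (G : nat -> hom (X n.+1) (X n.+2))
    (G' : nat -> hom (X n.+2) (X n.+3)) :
  connections_extend s G G' ->
  [/\ forall i j a, 1 <= i < j -> j <= n.+2 ->
        face X n.+2 a i ∘ G' j = G j.-1 ∘ face X n.+1 a i,
      connection_centered s G'
    & forall i j a, 1 <= j -> j.+1 < i <= n.+3 ->
        face X n.+2 a i ∘ G' j = G j ∘ face X n.+1 a i.-1].
Proof.
rewrite /connections_extend /connection_faces => GE.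
split=> [i j a ij jn|i j a jP ij|i j a ji iP]; rewrite GE; try lia.
- by have -> : i < j by lia.
- by have [-> ->] : (i < j) = false /\ (i <= j.+1) = true by lia.
- by have [-> ->] : (i < j) = false /\ (i <= j.+1) = false by lia.
Qed.

Lemma connections_exist :
  exists G : forall n, nat -> hom (X n.+1) (X n.+2), connections s G.
Proof.
pose C n (G : nat -> hom (X n.+1) (X n.+2)) := connection_centered s G /\
  forall j, 1 <= j <= n.+2 ->
    cubical_compatible n.+2 (face X n.+1) (connection_faces s G j).
have [||G GP] := @dependent_sequence _ C (fun n => @connections_extend A X s n).
- have [G Gm] := connections_base; exists G; split=> //.
  by apply: (connection_faces_compatible sP (U := fun _ _ _ => idm _)) => // *;
    lia.
- move=> n G [Gm /connections_step[G' G'E]]; exists G'; split=> //.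
  have [Gl G'm Gr] := connections_extendP G'E; split=> //.
  (* With this [U], the last assumption is a precubical identity composed with [G j]. *)
  apply: (connection_faces_compatible sP
    (U := fun j a i => G j ∘ face X n.+1 a i)) => // i i' j w a jP ii' i'P.
  by rewrite -!compA face_face.
exists G; split=> [n|n i j jP ij|n i j jP ij|n].
- by have [_ /connections_extendP[]] := GP n.
- by have [[-> //]] := GP n; lia.
- by have [[-> //]] := GP n; lia.
- by have [_ /connections_extendP[]] := GP n.
Qed.

End Connections.
End Resolution.

Theorem theorem3p4 (A : category) (P : A -> Prop) (B : A) (X : augmented B) :
  has_finite_limits A -> projective_class P ->
  P_projective_resolution P X ->
  (exists s : forall n : nat, nat -> hom (X n) (X n.+1),
     pseudodegeneracies s) /\
  (forall s : forall n : nat, nat -> hom (X n) (X n.+1),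
     pseudodegeneracies s ->
     exists G : forall n : nat, nat -> hom (X n.+1) (X n.+2),
       connections s G).
Proof.
move=> lim _ resX; split; first exact: (pseudodegeneracies_exist lim resX).
by move=> s sP; exact: (connections_exist lim resX sP).
Qed.
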